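(* Let $k$ be a field, let $m\geq 1$ and $n=2m+1$. Let $Q$ be the quiver with vertices $1,\dots,n$ whose underlying graph is the path $1-2-\cdots-n$ with the alternating orientation starting and ending with a sink, i.e. with arrows $2i\to 2i-1$ and $2i\to 2i+1$ for $1\leq i\leq m$, so that the sources are the vertices $2,4,\dots,2m$. Let $\mathcal{F}=\mathcal{F}_{\mathrm{src}}\sqcup\mathcal{F}_{1-\mathrm{src}}\sqcup\mathcal{F}_{\mathrm{src}-n}\sqcup\mathcal{F}_{1-n}$ be the union of the four sets $$\mathcal{F}_{\mathrm{src}}=\{[a,b]\colon a\leq b \text{ sources}\},\qquad \mathcal{F}_{\mathrm{src}-n}=\{[a,n]\colon a\text{ source}\},$$ $$\mathcal{F}_{1-\mathrm{src}}=\{[1,b]\colon b\text{ source}\},\qquad \mathcal{F}_{1-n}=\{[1,n]\}.$$ Then $\mathcal{F}$ is a maximum antichain in the poset $(\mathcal{P}_Q,\leq)$, of cardinality $\frac12 m(m+1)+2m+1$.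
   Context: A representation $V$ of a quiver $Q$ over $k$ assigns a finite-dimensional $k$-vector space $V_i$ to every vertex $i$ and a $k$-linear map $V_\alpha\colon V_i\to V_j$ to every arrow $\alpha\colon i\to j$. A morphism $\phi\colon V\to W$ is a family of linear maps $\phi_i\colon V_i\to W_i$ with $W_\alpha\circ\phi_i=\phi_j\circ V_\alpha$ for every arrow $\alpha\colon i\to j$; it is a monomorphism if every $\phi_i$ is injective. A vertex is a source if no arrow ends in it, and a sink if no arrow starts in it. For a quiver $Q$ whose underlying graph is the path $1-2-\cdots-n$ and for $1\leq a\leq b\leq n$, let $[a,b]$ denote the representation with $V_i=k$ for $a\leq i\leq b$ and $V_i=0$ otherwise, with $V_\alpha=\mathrm{id}_k$ for every arrow $\alpha$ between vertices in $\{a,\dots,b\}$ and $V_\alpha=0$ for all other arrows. (These represent all isomorphism classes of indecomposable representations of $Q$.) Let $\mathcal{P}_Q=\{[a,b]\colon 1\leq a\leq b\leq n\}$, ordered by $[a,b]\leq[a',b']$ if and only if there exists a monomorphism $[a,b]\hookrightarrow[a',b']$. An antichain in a poset is a subset of pairwise incomparable elements; it is maximum if no antichain has larger cardinality. *)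

(* Defs.v *)
From HB Require Import structures.
From mathcomp Require Import all_boot all_order all_algebra.

Set Implicit Arguments.
Unset Strict Implicit.
Unset Printing Implicit Defensive.

Import GRing.Theory.
Local Open Scope ring_scope.

Record quiver (I : finType) := Quiver {
  arrow : finType;
  src : arrow -> I;
  tgt : arrow -> I
}.

Definition is_source (I : finType) (Q : quiver I) (i : I) : bool :=
  [forall al : arrow Q, tgt al != i].

Record rep (k : fieldType) (I : finType) (Q : quiver I) := Rep {
  rep_space :> I -> vectType k;
  rep_map : forall al : arrow Q, 'Hom(rep_space (src al), rep_space (tgt al))
}.

Record rep_hom (k : fieldType) (I : finType) (Q : quiver I)
    (V W : rep k Q) := RepHom {
  hom_at :> forall i : I, 'Hom(V i, W i);
  hom_comm : forall al : arrow Q,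
    (rep_map W al \o hom_at (src al))%VF = (hom_at (tgt al) \o rep_map V al)%VF
}.

Definition rep_mono (k : fieldType) (I : finType) (Q : quiver I)
    (V W : rep k Q) (f : rep_hom V W) : Prop :=
  forall i : I, injective (f i).

(* The path 1 - 2 - ... - n has vertex type 'I_n: the ordinal with value i is *)
(* the vertex i + 1, so that ord0 is the vertex 1 and ord_max the vertex n.   *)
Definition interval (n : nat) : finType :=
  {ab : 'I_n * 'I_n | (ab.1 <= ab.2)%N}.

Definition left_end (n : nat) (x : interval n) : 'I_n := (val x).1.
Definition right_end (n : nat) (x : interval n) : 'I_n := (val x).2.

Definition in_interval (n : nat) (x : interval n) (i : 'I_n) : bool :=
  (left_end x <= i <= right_end x)%N.

(* The space at i is k^1 if i lies in x and k^0 = 0 otherwise. The matrix     *)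
(* pid_mx 1 is the 1 x 1 identity when both ends of the arrow lie in x; in    *)
(* all other cases it has no row or no column, and the map is zero.           *)
Definition interval_rep (k : fieldType) (n : nat) (Q : quiver 'I_n)
    (x : interval n) : rep k Q :=
  @Rep k 'I_n Q (fun i => 'rV[k]_(in_interval x i))
    (fun al => linfun (mulmxr (pid_mx 1))).

Definition interval_le (k : fieldType) (n : nat) (Q : quiver 'I_n)
    (x y : interval n) : Prop :=
  exists f : rep_hom (interval_rep k Q x) (interval_rep k Q y), rep_mono f.

Definition antichain (T : finType) (le : T -> T -> Prop) (A : {set T}) : Prop :=
  forall x y, x \in A -> y \in A -> x != y -> ~ (le x y \/ le y x).

Definition maximum_antichain (T : finType) (le : T -> T -> Prop)
    (A : {set T}) : Prop :=
  antichain le A /\ forall B : {set T}, antichain le B -> (#|B| <= #|A|)%N.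

(* For i < m the arrows (i, false) and (i, true) are 2(i+1) -> 2(i+1) - 1 and *)
(* 2(i+1) -> 2(i+1) + 1 in the numbering 1, ..., 2m + 1 of the vertices.      *)
Definition alternating_quiver (m : nat) : quiver 'I_(m.*2.+1) :=
  @Quiver 'I_(m.*2.+1) ('I_m * bool)%type
    (fun al => inord al.1.*2.+1)
    (fun al => if al.2 then inord al.1.*2.+2 else inord al.1.*2).

Definition F_src (n : nat) (Q : quiver 'I_n.+1) : {set interval n.+1} :=
  [set x | is_source Q (left_end x) && is_source Q (right_end x)].

Definition F_1_src (n : nat) (Q : quiver 'I_n.+1) : {set interval n.+1} :=
  [set x | (left_end x == ord0) && is_source Q (right_end x)].

Definition F_src_n (n : nat) (Q : quiver 'I_n.+1) : {set interval n.+1} :=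
  [set x | is_source Q (left_end x) && (right_end x == ord_max)].

Definition F_1_n (n : nat) : {set interval n.+1} :=
  [set x | (left_end x == ord0) && (right_end x == ord_max)].

Definition F_family (n : nat) (Q : quiver 'I_n.+1) : {set interval n.+1} :=
  F_src Q :|: F_1_src Q :|: F_src_n Q :|: F_1_n n.

Lemma src_alternatingE (m : nat) (al : arrow (alternating_quiver m)) :
  src al = al.1.*2.+1 :> nat.
Proof.
by rewrite /= inordK // ltnS ltn_double.
Qed.

Lemma tgt_alternatingE (m : nat) (al : arrow (alternating_quiver m)) :
  tgt al = (if al.2 then al.1.*2.+2 else al.1.*2) :> nat.
Proof.
have lt_al : (al.1.*2.+1 < m.*2)%N by rewrite ltn_Sdouble.
by rewrite /=; case: al.2; rewrite inordK // ltnS // ltnW // ltnW.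
Qed.

(* The sources are 2, 4, ..., 2m, i.e. the ordinals with odd value.           *)
Lemma is_source_alternating (m : nat) (i : 'I_(m.*2.+1)) : (0 < m)%N ->
  is_source (alternating_quiver m) i = odd i.
Proof.
move=> m_gt0; apply/forallP/idP => [src_i | odd_i al]; last first.
  apply: contraTneq odd_i => <-; rewrite tgt_alternatingE.
  by case: al.2; rewrite /= ?negbK odd_double.
apply: contraT => even_i; have i2 := even_halfK even_i.
have [lt_im | le_mi] := ltnP i./2 m.
  have /eqP[] := src_i (Ordinal lt_im, false).
  by apply: val_inj; rewrite [LHS]tgt_alternatingE /= i2.
have lt_m : (m.-1 < m)%N by rewrite prednK.
have /eqP[] := src_i (Ordinal lt_m, true).
apply: val_inj; rewrite [LHS]tgt_alternatingE /= -doubleS prednK //.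
by apply/eqP; rewrite eqn_leq -{1}i2 leq_double le_mi -ltnS ltn_ord.
Qed.

Lemma F_family_disjoint (m : nat) (Q := alternating_quiver m) : (0 < m)%N ->
  [/\ [disjoint F_src Q & F_1_src Q],
      [disjoint F_src Q :|: F_1_src Q & F_src_n Q] &
      [disjoint F_src Q :|: F_1_src Q :|: F_src_n Q & F_1_n m.*2]].
Proof.
move=> m_gt0; have srcE := is_source_alternating _ m_gt0.
have s0 : is_source Q ord0 = false by rewrite srcE.
have sn : is_source Q ord_max = false by rewrite srcE /= odd_double.
split; rewrite disjoint_subset; apply/subsetP => x; rewrite !inE.
- by case/andP=> + _; case: eqP => //= ->; rewrite s0.
- move=> x_F; rewrite negb_and orbC; case: eqP => //= xn.
  by move: x_F; rewrite xn sn !andbF.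
- case: eqP => //= ->; case: eqP => //= ->.
  by rewrite s0 sn ?andbF.
Qed.

Lemma interval_le_refl (k : fieldType) (n : nat) (Q : quiver 'I_n)
    (x : interval n) : interval_le k Q x x.
Proof.
have idP al : (rep_map (interval_rep k Q x) al \o \1)%VF
    = (\1 \o rep_map (interval_rep k Q x) al)%VF.
  by rewrite comp_lfun1r comp_lfun1l.
by exists (@RepHom _ _ _ _ _ (fun=> \1%VF) idP) => i u v /=; rewrite !id_lfunE.
Qed.

Lemma interval_le_trans (k : fieldType) (n : nat) (Q : quiver 'I_n)
    (x y z : interval n) :
  interval_le k Q x y -> interval_le k Q y z -> interval_le k Q x z.
Proof.
move=> [f inj_f] [g inj_g].
have fgP al : (rep_map (interval_rep k Q z) al \o (g (src al) \o f (src al)))%VF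
    = ((g (tgt al) \o f (tgt al)) \o rep_map (interval_rep k Q x) al)%VF.
  by rewrite comp_lfunA hom_comm -!comp_lfunA hom_comm.
exists (@RepHom _ _ _ _ _ (fun i => (g i \o f i)%VF) fgP) => i u v /=.
by rewrite !comp_lfunE => /inj_g/inj_f.
Qed.

Lemma interval_le_subset (k : fieldType) (n : nat) (Q : quiver 'I_n)
    (x y : interval n) (i : 'I_n) :
  interval_le k Q x y -> in_interval x i -> in_interval y i.
Proof.
move=> [f inj_f] x_i; apply: contraT => y'i; move: (f i) (inj_f i) => /= {inj_f f}.
rewrite x_i (negPf y'i) => f inj_f.
have /inj_f : f (const_mx 1) = f 0 by rewrite !thinmx0.
by move/rowP/(_ ord0)/eqP; rewrite !mxE oner_eq0.
Qed.

Lemma interval_le_anti (k : fieldType) (n : nat) (Q : quiver 'I_n)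
    (x y : interval n) :
  interval_le k Q x y -> interval_le k Q y x -> x = y.
Proof.
move=> le_xy le_yx.
have lx : in_interval x (left_end x) by rewrite /in_interval leqnn (valP x).
have rx : in_interval x (right_end x) by rewrite /in_interval leqnn (valP x).
have ly : in_interval y (left_end y) by rewrite /in_interval leqnn (valP y).
have ry : in_interval y (right_end y) by rewrite /in_interval leqnn (valP y).
have /andP[lx1 _] := interval_le_subset le_xy lx.
have /andP[_ rx1] := interval_le_subset le_xy rx.
have /andP[ly1 _] := interval_le_subset le_yx ly.
have /andP[_ ry1] := interval_le_subset le_yx ry.
have lxy : left_end x = left_end y by apply/val_inj/anti_leq; rewrite lx1 ly1.
have rxy : right_end x = right_end y by apply/val_inj/anti_leq; rewrite rx1 ry1.
move: lxy rxy; rewrite /left_end /right_end => lxy rxy; apply: val_inj.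
by case: (val x) (val y) lxy rxy => [a b] [c d] /= -> ->.
Qed.

(* Main.v *)
From mathcomp Require Import all_boot all_order all_algebra.
From mathcomp Require Import zify.
Require Import Defs.

Set Implicit Arguments.
Unset Strict Implicit.
Unset Printing Implicit Defensive.

Import GRing.Theory.

(** A monomorphism identifies [x] with a subrepresentation of [y]. The nonzero
    spaces being lines, a subrepresentation is determined by its support, which
    can be any subset of [y] closed under the arrows between vertices of [y]
    ([interval_leP]). For the alternating quiver, with vertices numbered from 0
    and sources the odd ones, closure concerns the two ends of [x] alone: an end
    of [x] may differ from that of [y] only if it is even, since from an odd end
    an arrow would lead out of [x] into [y] ([alternating_leP]).

    The ends of the members of F are odd, or at the boundary of the path where
    they cannot move outwards; hence F is an antichain.

    For the upper bound the poset is partitioned into |F| chains, each with its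
    top in F. With odd [c <= d], and [2m] the last vertex, they are
    - [c,d] > [c,d-1] > [c+1,d-1], cut to [c,d] alone when [c = d];
    - [0,d] > [2,d] > ... > [d-1,d];
    - [c,2m] > [c+1,2m];
    - [0,2m] > [0,2m-2] > ... > [0,0].
    The chain of an interval is recorded by a pair of indices ([chain_code]),
    where a top [a,b] has code [(uphalf a, b./2)]. An antichain meets each chain
    at most once ([antichain_inj]), so it has at most as many elements as there
    are codes [(i,j)] with [i <= j + 1] and [i, j <= m]; F attains all of
    these, and counting the codes gives its cardinality. *)

(** * Monomorphisms between interval representations *)

(** The maps of an interval representation, and the monomorphism constructed
    in [interval_leP], are all right multiplications by such matrices. These
    compose functorially unless a zero space stands between two nonzero ones. *)
Lemma pid_mx_comp (k : fieldType) (p q r : bool) : (p -> r -> q) ->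
  ((pid_mx 1 : 'M[k]_(p, q)) *m (pid_mx 1 : 'M[k]_(q, r)) = pid_mx 1)%R.
Proof.
case: p => [|_]; last by rewrite [LHS]flatmx0 [RHS]flatmx0.
case: r => [pqr|_]; last by rewrite [LHS]thinmx0 [RHS]thinmx0.
by rewrite pqr // mul_pid_mx.
Qed.

Lemma pid_mx_inj (k : fieldType) (p q : bool) : (p -> q) ->
  injective (mulmxr (pid_mx 1 : 'M[k]_(p, q)) : 'rV[k]_p -> 'rV[k]_q).
Proof.
move=> pq; apply: (can_inj (g := mulmxr (pid_mx 1))) => u /=.
rewrite -mulmxA pid_mx_comp => [|p1 _]; last exact: pq.
by rewrite -[RHS]mulmx1 -pid_mx_1; move: u; case: (p) => u //; rewrite !thinmx0.
Qed.

(** If an arrow starts in [x] but ends in [y] outside [x], then commutation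
    forces the nonzero map of [y] to vanish on the image of [x]. *)
Lemma interval_le_closed (k : fieldType) (n : nat) (Q : quiver 'I_n)
    (x y : interval n) (al : arrow Q) : interval_le k Q x y ->
  in_interval x (src al) -> in_interval y (tgt al) -> in_interval x (tgt al).
Proof.
move=> le_xy xs yt; have ys := interval_le_subset le_xy xs.
apply: contraT => x't; have [f inj_f] := le_xy.
move: (hom_comm f al) (inj_f (src al)) => /=.
move: (hom_at f (src al)) (hom_at f (tgt al)) => /=.
rewrite xs ys yt (negPf x't) => fs ft comm inj_fs.
have inj_y := @pid_mx_inj k true true id.
have zero u : (mulmxr (pid_mx 1 : 'M[k]_(true, true)) (fs u) = 0)%R.
  have := congr1 (fun g => fun_of_lfun g u) comm.
  rewrite !comp_lfunE !lfunE /= => ->.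
  by rewrite (thinmx0 (u *m _)%R) linear0.
have /inj_y/inj_fs : mulmxr (pid_mx 1 : 'M[k]_(true, true)) (fs (const_mx 1%R))
   = mulmxr (pid_mx 1 : 'M[k]_(true, true)) (fs 0%R) by rewrite !zero.
by move/rowP/(_ ord0)/eqP; rewrite !mxE oner_eq0.
Qed.

Lemma interval_leP (k : fieldType) (n : nat) (Q : quiver 'I_n)
    (x y : interval n) :
  interval_le k Q x y <->
    (forall i, in_interval x i -> in_interval y i) /\
    (forall al : arrow Q, in_interval x (src al) -> in_interval y (tgt al) ->
       in_interval x (tgt al)).
Proof.
split=> [le_xy | [sub_xy closed_xy]].
  by split=> *; [apply: interval_le_subset le_xy _
                | apply: interval_le_closed le_xy _ _].
pose f i : 'Hom(interval_rep k Q x i, interval_rep k Q y i) :=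
  linfun (mulmxr (pid_mx 1 : 'M[k]_(in_interval x i, in_interval y i))).
have fP al : (rep_map (interval_rep k Q y) al \o f (src al))%VF
    = (f (tgt al) \o rep_map (interval_rep k Q x) al)%VF.
  apply/lfunP => u; rewrite !comp_lfunE /= !lfunE /= -!mulmxA.
  by rewrite !pid_mx_comp // => [|xs _]; [apply: closed_xy | apply: sub_xy].
exists (RepHom fP) => i u v; rewrite /= !lfunE.
by apply: pid_mx_inj; apply: sub_xy.
Qed.

(** * The order for the alternating quiver *)

Lemma interval_eqP (n : nat) (x y : interval n) :
  left_end x = left_end y :> nat -> right_end x = right_end y :> nat -> x = y.
Proof.
move=> /val_inj + /val_inj; rewrite /left_end /right_end => ea eb.
by apply: val_inj; rewrite [val x]surjective_pairing ea eb -surjective_pairing.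
Qed.

Lemma interval_ends (n : nat) (x : interval n.+1) :
  left_end x <= right_end x <= n.
Proof. by rewrite (valP x) -ltnS ltn_ord. Qed.

(** Vertices are numbered from 0, so that the sources are the odd ones. An end
    of [x] at a source is joined to the vertex just beyond it by an arrow
    leaving [x], and this vertex must therefore not lie in [y]. *)
Lemma alternating_leP (k : fieldType) (m : nat)
    (x y : interval m.*2.+1) :
  interval_le k (alternating_quiver m) x y <->
    [&& left_end y <= left_end x, right_end x <= right_end y,
        (left_end x == left_end y :> nat) || ~~ odd (left_end x) &
        (right_end x == right_end y :> nat) || ~~ odd (right_end x)].
Proof.
have := interval_ends x; have := interval_ends y => yE xE.
split=> [le_xy | le_xy]; last first.
  apply/interval_leP; split=> [i | al]; rewrite /in_interval.
    lia.
  by rewrite src_alternatingE tgt_alternatingE; case: al.2; lia.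
have [sub_xy closed_xy] := (interval_leP _ _ _ _).1 le_xy.
have lx : left_end y <= left_end x.
  by have := sub_xy (left_end x); rewrite /in_interval; lia.
have rx : right_end x <= right_end y.
  by have := sub_xy (right_end x); rewrite /in_interval; lia.
have closed (i : nat) (b : bool) :
    i < m -> left_end x <= i.*2.+1 <= right_end x ->
    left_end y <= (if b then i.*2.+2 else i.*2) <= right_end y ->
    left_end x <= (if b then i.*2.+2 else i.*2) <= right_end x.
  move=> im; have := closed_xy (Ordinal im, b).
  by rewrite /in_interval src_alternatingE tgt_alternatingE.
have := closed (left_end x)./2 false; have := closed (right_end x)./2 true.
lia.
Qed.

(** * The chain decomposition *)

(** Two members of [A] in the same fibre would be comparable. *)
Lemma antichain_inj (T : finType) (S : Type) (le : T -> T -> Prop) (f : T -> S)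
    (A : {set T}) :
  (forall x y, f x = f y -> le x y \/ le y x) -> antichain le A ->
  {in A &, injective f}.
Proof.
move=> chain_f antiA x y Ax Ay /chain_f cmp_xy; apply/eqP.
by apply: contraT => /(antiA x y Ax Ay)[].
Qed.

(** The ends of a top determine its code and conversely: left ends that are odd
    or zero are told apart by their upper halves, right ends that are odd or
    equal to [m.*2] by their halves. The two exceptional cases send [a,b] with
    [a] even and [b] odd to the chain of [0,b], and [0,b] with [b] even to the
    chain of [0,2m]. *)
Definition chain_code (m : nat) (x : interval m.*2.+1) : 'I_m.+1 * 'I_m.+1 :=
  let a := left_end x in let b := right_end x in
  (inord (if odd b && ~~ odd a then 0 else uphalf a),
   inord (if ~~ odd b && (a == 0 :> nat) then m else b./2)).

Lemma chain_codeE (m : nat) (x : interval m.*2.+1)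
    (a := left_end x) (b := right_end x) :
  ((chain_code x).1 = (if odd b && ~~ odd a then 0 else uphalf a) :> nat) *
  ((chain_code x).2 = (if ~~ odd b && (a == 0 :> nat) then m else b./2) :> nat).
Proof.
have := interval_ends x; rewrite {}/a {}/b => xE.
by split; rewrite inordK //; case: ifP; lia.
Qed.

Lemma chain_code_chain (k : fieldType) (m : nat) (x y : interval m.*2.+1) :
  chain_code x = chain_code y ->
  interval_le k (alternating_quiver m) x y \/
  interval_le k (alternating_quiver m) y x.
Proof.
move=> /[dup] /(congr1 (fun c => val c.1)) /= + /(congr1 (fun c => val c.2)) /=.
rewrite !chain_codeE => e1 e2; rewrite !alternating_leP; apply/orP.
have := interval_ends x; have := interval_ends y.
move: e1 e2; do 4?[case: ifP]; lia.
Qed.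

(** The constraint is what [a <= b] leaves of itself after halving: the tops of
    the chains at the boundary of the constraint are the [c,c] with [c] odd. *)
Definition chain_codes (m : nat) : {set 'I_m.+1 * 'I_m.+1} :=
  [set c : 'I_m.+1 * 'I_m.+1 | c.1 <= c.2.+1].

Lemma chain_code_in (m : nat) (x : interval m.*2.+1) :
  chain_code x \in chain_codes m.
Proof.
rewrite inE !chain_codeE; have := interval_ends x.
by do 2?[case: ifP]; lia.
Qed.

(** For fixed [j < m] there are [j + 2] codes [(i,j)], while for [j = m] the
    condition [i <= j + 1] is vacuous and there are [m + 1]. *)
Lemma card_chain_codes (m : nat) :
  #|chain_codes m| = (m * (m + 1)) %/ 2 + 2 * m + 1.
Proof.
have count_lt k : k <= m.+1 -> \sum_(i < m.+1 | i < k) 1 = k.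
  by move=> le_km; rewrite -(big_ord_widen _ (fun=> 1)) // sum1_card card_ord.
have sum_succ2 : forall k, (\sum_(j < k) j.+2).*2 = k * (k + 3).
  elim=> [|k IHk]; first by rewrite big_ord0.
  by rewrite big_ord_recr doubleD IHk /=; nia.
have -> : #|chain_codes m| = \sum_(j < m.+1) \sum_(i < m.+1 | i < j.+2) 1.
  rewrite -sum1dep_card (exchange_big_dep xpredT) //=.
  by rewrite (pair_big_dep xpredT (fun i j : 'I_m.+1 => i < j.+2)
                (fun _ _ => 1)).
rewrite big_ord_recr (eq_bigr (fun j : 'I_m => j.+2)) => [|j _].
  rewrite (eq_bigl (fun i : 'I_m.+1 => i < m.+1)) => [|i].
    by rewrite count_lt //= -[X in X + _]doubleK sum_succ2; lia.
  by have := ltn_ord i; rewrite /=; lia.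
by rewrite count_lt //= ltnS.
Qed.

(** * The family F *)

Lemma in_F_family (m : nat) (x : interval m.*2.+1) : 0 < m ->
  (x \in F_family (alternating_quiver m)) =
    ((left_end x == 0 :> nat) || odd (left_end x)) &&
    ((right_end x == m.*2 :> nat) || odd (right_end x)).
Proof.
move=> m_gt0; rewrite !inE !is_source_alternating // -!val_eqE /=.
by do 2![case: (odd _); case: eqP => //=].
Qed.

(** The members of F are maximal in the poset: each of their ends is a source
    or a boundary vertex of the path, hence cannot move outwards. *)
Lemma F_family_antichain (k : fieldType) (m : nat) : 0 < m ->
  antichain (interval_le k (alternating_quiver m))
    (F_family (alternating_quiver m)).
Proof.
move=> m_gt0; suff maxF x y : x \in F_family (alternating_quiver m) ->
    interval_le k (alternating_quiver m) x y -> x = y.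
  move=> x y Fx Fy /eqP neq_xy [/maxF | /maxF] eq_xy; apply: neq_xy.
    exact: eq_xy.
  by rewrite eq_xy.
rewrite in_F_family // => Fx /alternating_leP le_xy.
by have := interval_ends y => yE; apply: interval_eqP; lia.
Qed.

Lemma chain_code_F_family (m : nat) : 0 < m ->
  [set chain_code x | x in F_family (alternating_quiver m)] = chain_codes m.
Proof.
move=> m_gt0; apply/setP => c; apply/imsetP/idP => [[x _ ->] | ].
  exact: chain_code_in.
case: c => i j; rewrite inE /= => le_ij.
have [lt_im lt_jm] := (ltn_ord i, ltn_ord j).
(* The top with code [(i, j)]; the truncated predecessor gives 0 for [i = 0],
   and the minimum gives the last vertex for [j = m]. *)
pose a := i.*2.-1; pose b := minn j.*2.+1 m.*2.
have lt_a : a < m.*2.+1 by rewrite /a; lia.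
have lt_b : b < m.*2.+1 by rewrite /b; lia.
have le_ab : a <= b by rewrite /a /b; lia.
pose x : interval m.*2.+1 :=
  exist _ (Ordinal lt_a, Ordinal lt_b) le_ab.
exists x; first by rewrite in_F_family //= /a /b; lia.
rewrite [chain_code x]surjective_pairing.
by congr (_, _); apply: ord_inj; rewrite chain_codeE /= /a /b; case: ifP; lia.
Qed.

Theorem theorem2p8 (k : fieldType) (m : nat) (hm : (1 <= m)%N) :
  maximum_antichain (interval_le k (alternating_quiver m))
    (F_family (alternating_quiver m)) /\
  #|F_family (alternating_quiver m)| = ((m * (m + 1)) %/ 2 + 2 * m + 1)%N.
Proof.
have inj_code A := @antichain_inj _ _ _ _ A (@chain_code_chain k m).
have antiF := F_family_antichain (k := k) hm.
have cardF : #|F_family (alternating_quiver m)| = #|chain_codes m|.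
  by rewrite -(chain_code_F_family hm) card_in_imset //; apply: inj_code.
split; last by rewrite cardF card_chain_codes.
split=> // B /inj_code/card_in_imset <-; rewrite cardF.
apply: subset_leq_card; apply/subsetP => _ /imsetP[x _ ->].
exact: chain_code_in.
Qed.
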